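(* Let $\mu\in\mathbb{R}$ be a constant, let $D\subset\mathbb{R}^2$ be a domain and let $f=(f^1,f^2):D\to\mathbb{R}^2$ be an anti CR map with $1-|\nabla f^1|^2\ne0$ on $D$. If $$\zeta=\frac{2\mu|\nabla f^1|^2}{1-|\nabla f^1|^2}\qquad\text{on } D,$$ then $$\zeta(2\mu+\zeta)\,\Delta\zeta-2(\mu+\zeta)\,|\nabla\zeta|^2=0 .$$
   Context: A smooth map $f=(f^1,f^2)$ of $z=(z_1,z_2)$ is an anti CR map if $\partial_{z_1}f^1+\partial_{z_2}f^2=0$ and $\partial_{z_2}f^1-\partial_{z_1}f^2=0$. $\nabla$ and $\Delta$ are the gradient and Laplacian in $z$. *)

(* Defs.v *)
From Stdlib Require Import Reals.
From Coquelicot Require Import Coquelicot.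

Open Scope R_scope.

(* Real functions on a subset D of R^2 are total functions R -> R -> R of which
   only the values on D matter; D itself is a predicate on R * R, so that
   Coquelicot's [open] applies. *)

Definition connected_set {T : UniformSpace} (D : T -> Prop) : Prop :=
  forall U V : T -> Prop,
    open U -> open V ->
    (forall p, D p -> U p \/ V p) ->
    (exists p, D p /\ U p) ->
    (exists p, D p /\ V p) ->
    exists p, D p /\ U p /\ V p.

Definition is_domain (D : R * R -> Prop) : Prop :=
  (exists p, D p) /\ open D /\ connected_set D.

(* [ex_diff_n g n x y] says that the partial derivatives of g of order <= n
   exist and are continuous at (x, y); asked at every point of an open set D,
   it says that g is C^n on D. *)
Definition smooth_on (D : R * R -> Prop) (g : R -> R -> R) : Prop :=
  forall (n : nat) (x y : R), D (x, y) -> ex_diff_n g n x y.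

Definition anti_CR (D : R * R -> Prop) (f1 f2 : R -> R -> R) : Prop :=
  smooth_on D f1 /\ smooth_on D f2 /\
  forall x y : R, D (x, y) ->
    partial_derive 1 0 f1 x y + partial_derive 0 1 f2 x y = 0 /\
    partial_derive 0 1 f1 x y - partial_derive 1 0 f2 x y = 0.

Definition grad (g : R -> R -> R) (x y : R) : R * R :=
  (partial_derive 1 0 g x y, partial_derive 0 1 g x y).

(* Coquelicot's norm on a product of normed modules is the Euclidean one. *)
Definition grad_norm (g : R -> R -> R) (x y : R) : R := norm (grad g x y).

Definition laplacian (g : R -> R -> R) (x y : R) : R :=
  partial_derive 2 0 g x y + partial_derive 0 2 g x y.

(* Main.v *)
Require Import Defs.
From Stdlib Require Import Reals Lra.
From Coquelicot Require Import Coquelicot.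

Open Scope R_scope.

(** Cross-differentiating the anti CR equations shows that [f^1] is harmonic.
    Hence the components [a], [b] of its gradient satisfy [a_x = - b_y] and
    [a_y = b_x], are harmonic themselves, and [u = a^2 + b^2] satisfies
    [u Δu = |∇u|^2] ([log u] is harmonic where [u <> 0]). The claimed equation
    is this identity rewritten through the Möbius change of variable
    [zeta = 2 mu u / (1 - u)]. *)

(** Convertible with [partial_derive 1 0 g] and [partial_derive 0 1 g], but shaped as operators that
    can be composed. *)
Definition dx (g : R -> R -> R) (x y : R) : R := Derive (fun t => g t y) x.
Definition dy (g : R -> R -> R) (x y : R) : R := Derive (fun t => g x t) y.

Section OpenSet.

Variable D : R * R -> Prop.
Hypothesis openD : open D.

Lemma open_locally_2d (P : R -> R -> Prop) :
  (forall x y, D (x, y) -> P x y) ->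
  forall x y, D (x, y) -> locally_2d P x y.
Proof.
  intros H x y Dxy. apply locally_2d_locally.
  apply (filter_imp D); [intros [u v]; apply H | exact (openD _ Dxy)].
Qed.

Lemma open_locally_x (P : R -> R -> Prop) :
  (forall x y, D (x, y) -> P x y) ->
  forall x y, D (x, y) -> locally x (fun t => P t y).
Proof.
  intros H x y Dxy. now apply locally_2d_1d_const_y, open_locally_2d.
Qed.

Lemma open_locally_y (P : R -> R -> Prop) :
  (forall x y, D (x, y) -> P x y) ->
  forall x y, D (x, y) -> locally y (fun t => P x t).
Proof.
  intros H x y Dxy. now apply locally_2d_1d_const_x, open_locally_2d.
Qed.

(** Since [D] is open, an identity known only on [D] holds near each of its points and may be
    differentiated. *)
Lemma dx_ext (g h : R -> R -> R) :
  (forall x y, D (x, y) -> g x y = h x y) ->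
  forall x y, D (x, y) -> dx g x y = dx h x y.
Proof.
  intros H x y Dxy. apply Derive_ext_loc.
  exact (open_locally_x (fun u v => g u v = h u v) H x y Dxy).
Qed.

Lemma dy_ext (g h : R -> R -> R) :
  (forall x y, D (x, y) -> g x y = h x y) ->
  forall x y, D (x, y) -> dy g x y = dy h x y.
Proof.
  intros H x y Dxy. apply Derive_ext_loc.
  exact (open_locally_y (fun u v => g u v = h u v) H x y Dxy).
Qed.

Lemma smooth_dx (g : R -> R -> R) : smooth_on D g -> smooth_on D (dx g).
Proof.
  intros H n x y Dxy. exact (ex_diff_n_deriv_aux1 g n x y (H (S n) x y Dxy)).
Qed.

Lemma smooth_dy (g : R -> R -> R) : smooth_on D g -> smooth_on D (dy g).
Proof.
  intros H n x y Dxy. exact (ex_diff_n_deriv_aux2 g n x y (H (S n) x y Dxy)).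
Qed.

Lemma smooth_is_derive_x (g : R -> R -> R) (x y : R) :
  smooth_on D g -> D (x, y) -> is_derive (fun t => g t y) x (dx g x y).
Proof.
  intros H Dxy. apply Derive_correct, (H 1%nat x y Dxy).
Qed.

Lemma smooth_is_derive_y (g : R -> R -> R) (x y : R) :
  smooth_on D g -> D (x, y) -> is_derive (fun t => g x t) y (dy g x y).
Proof.
  intros H Dxy. apply Derive_correct, (H 1%nat x y Dxy).
Qed.

Lemma smooth_continuous (g : R -> R -> R) (x y : R) :
  smooth_on D g -> D (x, y) -> continuity_2d_pt g x y.
Proof.
  intros H Dxy. apply (H 0%nat x y Dxy).
Qed.

Lemma smooth_dx_dy (g : R -> R -> R) (x y : R) :
  smooth_on D g -> D (x, y) -> dx (dy g) x y = dy (dx g) x y.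
Proof.
  intros H Dxy. apply (Schwarz g).
  - revert x y Dxy. apply open_locally_2d. intros x y Dxy.
    repeat split; eexists.
    + now apply smooth_is_derive_x.
    + now apply smooth_is_derive_y.
    + apply (smooth_is_derive_x (dy g)); [now apply smooth_dy | easy].
    + apply (smooth_is_derive_y (dx g)); [now apply smooth_dx | easy].
  - apply (smooth_continuous (dx (dy g))); [now apply smooth_dx, smooth_dy | easy].
  - apply (smooth_continuous (dy (dx g))); [now apply smooth_dy, smooth_dx | easy].
Qed.

Definition harmonic (g : R -> R -> R) : Prop :=
  forall x y, D (x, y) -> dx (dx g) x y + dy (dy g) x y = 0.

Lemma dx_opp (g : R -> R -> R) (x y : R) :
  dx (fun u v => - g u v) x y = - dx g x y.
Proof. exact (Derive_opp (fun t => g t y) x). Qed.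

Lemma dy_opp (g : R -> R -> R) (x y : R) :
  dy (fun u v => - g u v) x y = - dy g x y.
Proof. exact (Derive_opp (fun t => g x t) y). Qed.

(** The system gives [g_xx = - h_yx] and [g_yy = h_xy], which cancel by the symmetry of the mixed
    derivatives of [h]. *)
Lemma cauchy_riemann_harmonic (g h : R -> R -> R) :
  smooth_on D h ->
  (forall x y, D (x, y) -> dx g x y + dy h x y = 0) ->
  (forall x y, D (x, y) -> dy g x y - dx h x y = 0) ->
  harmonic g.
Proof.
  intros Sh Hx Hy x y Dxy.
  rewrite (dx_ext (dx g) (fun u v => - dy h u v)), dx_opp; try easy.
  2: { intros u v Duv. specialize (Hx u v Duv). lra. }
  rewrite (dy_ext (dy g) (dx h)), smooth_dx_dy; try easy.
  2: { intros u v Duv. specialize (Hy u v Duv). lra. }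
  ring.
Qed.

(** The pair [(dx g, dy g)] solves the same first-order system: one equation is the harmonicity of
    [g], the other is Schwarz's theorem. *)
Lemma harmonic_dx (g : R -> R -> R) :
  smooth_on D g -> harmonic g -> harmonic (dx g).
Proof.
  intros Sg Hg. apply (cauchy_riemann_harmonic _ (dy g)); try easy.
  - now apply smooth_dy.
  - intros x y Dxy. rewrite (smooth_dx_dy g); try easy. ring.
Qed.

(** Two uses of Schwarz's theorem turn [g_yxx] into [g_xxy], and differentiating [g_xx = - g_yy] in
    [y] finishes. *)
Lemma harmonic_dy (g : R -> R -> R) :
  smooth_on D g -> harmonic g -> harmonic (dy g).
Proof.
  intros Sg Hg x y Dxy.
  rewrite (dx_ext (dx (dy g)) (dy (dx g))); try easy.
  2: { intros u v Duv. now apply smooth_dx_dy. }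
  rewrite (smooth_dx_dy (dx g)); [| now apply smooth_dx | easy].
  rewrite (dy_ext (dx (dx g)) (fun u v => - dy (dy g) u v)), dy_opp; try easy.
  2: { intros u v Duv. specialize (Hg u v Duv). lra. }
  ring.
Qed.

End OpenSet.

Lemma grad_norm_sqr (g : R -> R -> R) (x y : R) :
  grad_norm g x y ^ 2 = dx g x y ^ 2 + dy g x y ^ 2.
Proof.
  (* The product norm on [R * R] unfolds to this expression by conversion. *)
  change (sqrt (Rabs (dx g x y) ^ 2 + Rabs (dy g x y) ^ 2) ^ 2
          = dx g x y ^ 2 + dy g x y ^ 2).
  rewrite pow2_sqrt, !pow2_abs; [reflexivity|].
  apply Rplus_le_le_0_compat; apply pow2_ge_0.
Qed.

Lemma laplacian_dx_dy (g : R -> R -> R) (x y : R) :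
  laplacian g x y = dx (dx g) x y + dy (dy g) x y.
Proof. reflexivity. Qed.

(** Chain rule for [z = 2 mu u / (1 - u)] along a line, with [u = p^2 + q^2]: the map [u / (1 - u)]
    has derivatives [1 / (1 - u)^2] and [2 / (1 - u)^3]. It serves for both coordinate
    directions. *)
Lemma moebius_sqr_derivatives (mu : R) (p q p' q' z : R -> R) (p'' q'' t : R) :
  locally t (fun s => is_derive p s (p' s)) ->
  locally t (fun s => is_derive q s (q' s)) ->
  is_derive p' t p'' -> is_derive q' t q'' ->
  locally t (fun s => 1 - (p s ^ 2 + q s ^ 2) <> 0) ->
  locally t (fun s =>
    z s = 2 * mu * (p s ^ 2 + q s ^ 2) / (1 - (p s ^ 2 + q s ^ 2))) ->
  let u := p t ^ 2 + q t ^ 2 in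
  let u' := 2 * (p t * p' t + q t * q' t) in
  let u'' := 2 * (p' t ^ 2 + q' t ^ 2 + p t * p'' + q t * q'') in
  Derive z t = 2 * mu * u' / (1 - u) ^ 2 /\
  Derive (Derive z) t
    = 2 * mu * (u'' * (1 - u) + 2 * u' ^ 2) / (1 - u) ^ 3.
Proof.
  intros Hp Hq Hp' Hq' Hne Hz u u' u''.
  set (z' := fun s => 2 * mu * (2 * (p s * p' s + q s * q' s))
                      / (1 - (p s ^ 2 + q s ^ 2)) ^ 2).
  (* The second derivative needs the formula for the first one on a whole neighbourhood of [t].
     Differentiating at a nearby [s] in turn needs the formula for [z] around [s], hence
     [locally_locally]. *)
  assert (Hz' : locally t (fun s => Derive z s = z' s)).
  { apply locally_locally in Hz.
    generalize (filter_and _ _ (filter_and _ _ Hp Hq) (filter_and _ _ Hne Hz)).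
    apply filter_imp. intros s [[Ps Qs] [Ns Zs]].
    rewrite (Derive_ext_loc _ _ _ Zs). apply is_derive_unique.
    (* [auto_derive] expresses its result through [Derive] of the abstract functions; these
       equations evaluate those terms. *)
    assert (Ep : Derive (fun r => p r) s = p' s) by now apply is_derive_unique.
  assert (Eq : Derive (fun r => q r) s = q' s) by now apply is_derive_unique.
    auto_derive.
    - repeat split; try (eexists; eassumption). simpl in Ns. exact Ns.
    - rewrite Ep, Eq. unfold z'. field. simpl in Ns. lra. }
  apply locally_singleton in Hp. apply locally_singleton in Hq.
  apply locally_singleton in Hne.
  split; [exact (locally_singleton _ _ Hz')|].
  rewrite (Derive_ext_loc _ _ _ Hz'). apply is_derive_unique.
  assert (Ep : Derive (fun r => p r) t = p' t) by now apply is_derive_unique.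
  assert (Eq : Derive (fun r => q r) t = q' t) by now apply is_derive_unique.
  assert (Ep' : Derive (fun r => p' r) t = p'') by now apply is_derive_unique.
  assert (Eq' : Derive (fun r => q' r) t = q'') by now apply is_derive_unique.
  unfold z'. auto_derive.
  - repeat split; try (eexists; eassumption).
    change ((1 - (p t ^ 2 + q t ^ 2)) ^ 2 <> 0). now apply pow_nonzero.
  - rewrite Ep, Eq, Ep', Eq'. unfold u'', u', u. field. simpl in Hne. lra.
Qed.

Theorem lemma6p2 (mu : R) (D : R * R -> Prop) (f1 f2 zeta : R -> R -> R)
    (hD : is_domain D)
    (hf : anti_CR D f1 f2)
    (hne : forall x y : R, D (x, y) -> 1 - grad_norm f1 x y ^ 2 <> 0)
    (hzeta : forall x y : R, D (x, y) ->
       zeta x y =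
         2 * mu * grad_norm f1 x y ^ 2 / (1 - grad_norm f1 x y ^ 2)) :
  forall x y : R, D (x, y) ->
    zeta x y * (2 * mu + zeta x y) * laplacian zeta x y
      - 2 * (mu + zeta x y) * grad_norm zeta x y ^ 2 = 0.
Proof.
  destruct hD as [_ [oD _]]. destruct hf as [S1 [S2 CR]].
  set (a := dx f1). set (b := dy f1).
  assert (Sa : smooth_on D a) by now apply smooth_dx.
  assert (Sb : smooth_on D b) by now apply smooth_dy.
  assert (H1 : harmonic D f1).
  { apply (cauchy_riemann_harmonic D oD f1 f2); try easy; apply CR. }
  assert (Ha : harmonic D a) by now apply harmonic_dx.
  assert (Hb : harmonic D b) by now apply harmonic_dy.
  assert (hne' : forall x y, D (x, y) -> 1 - (a x y ^ 2 + b x y ^ 2) <> 0).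
  { intros x y Dxy. unfold a, b. rewrite <- grad_norm_sqr. now apply hne. }
  assert (hzeta' : forall x y, D (x, y) -> zeta x y =
     2 * mu * (a x y ^ 2 + b x y ^ 2) / (1 - (a x y ^ 2 + b x y ^ 2))).
  { intros x y Dxy. unfold a, b. rewrite <- grad_norm_sqr. now apply hzeta. }
  intros x y Dxy.
  (* The horizontal slice through [(x, y)] gives the [x]-derivatives of [zeta]; the vertical slice,
     treated next, gives the [y]-derivatives. *)
  destruct (moebius_sqr_derivatives mu
    (fun t => a t y) (fun t => b t y) (fun t => dx a t y) (fun t => dx b t y)
    (fun t => zeta t y) (dx (dx a) x y) (dx (dx b) x y) x) as [zx zxx].
  { apply (open_locally_x D oD (fun u v => is_derive (fun t => a t v) u (dx a u v))); [|easy].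
    intros u v. now apply smooth_is_derive_x. }
  { apply (open_locally_x D oD (fun u v => is_derive (fun t => b t v) u (dx b u v))); [|easy].
    intros u v. now apply smooth_is_derive_x. }
  { apply (smooth_is_derive_x D); [now apply smooth_dx | easy]. }
  { apply (smooth_is_derive_x D); [now apply smooth_dx | easy]. }
  { exact (open_locally_x D oD _ hne' x y Dxy). }
  { exact (open_locally_x D oD _ hzeta' x y Dxy). }
  destruct (moebius_sqr_derivatives mu
    (fun t => a x t) (fun t => b x t) (fun t => dy a x t) (fun t => dy b x t)
    (fun t => zeta x t) (dy (dy a) x y) (dy (dy b) x y) y) as [zy zyy].
  { apply (open_locally_y D oD (fun u v => is_derive (fun t => a u t) v (dy a u v))); [|easy].
    intros u v. now apply smooth_is_derive_y. }
  { apply (open_locally_y D oD (fun u v => is_derive (fun t => b u t) v (dy b u v))); [|easy].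
    intros u v. now apply smooth_is_derive_y. }
  { apply (smooth_is_derive_y D); [now apply smooth_dy | easy]. }
  { apply (smooth_is_derive_y D); [now apply smooth_dy | easy]. }
  { exact (open_locally_y D oD _ hne' x y Dxy). }
  { exact (open_locally_y D oD _ hzeta' x y Dxy). }
  change (dx zeta x y = 2 * mu * (2 * (a x y * dx a x y + b x y * dx b x y))
          / (1 - (a x y ^ 2 + b x y ^ 2)) ^ 2) in zx.
  change (dy zeta x y = 2 * mu * (2 * (a x y * dy a x y + b x y * dy b x y))
          / (1 - (a x y ^ 2 + b x y ^ 2)) ^ 2) in zy.
  match type of zxx with _ = ?r => change (dx (dx zeta) x y = r) in zxx end.
  match type of zyy with _ = ?r => change (dy (dy zeta) x y = r) in zyy end.
  rewrite laplacian_dx_dy, grad_norm_sqr, zx, zy, zxx, zyy, hzeta' by easy.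
  (* All [y]-derivatives are eliminated: [a_y = b_x] by Schwarz, [b_y = - a_x] by harmonicity of
     [f1], and the second ones by harmonicity of [a] and [b]. *)
  replace (dy a x y) with (dx b x y) by now apply (smooth_dx_dy D).
  replace (dy b x y) with (- dx a x y)
    by (specialize (H1 x y Dxy); fold a b in H1; lra).
  replace (dy (dy a) x y) with (- dx (dx a) x y) by (specialize (Ha x y Dxy); lra).
  replace (dy (dy b) x y) with (- dx (dx b) x y) by (specialize (Hb x y Dxy); lra).
  (* With [u = a^2 + b^2], the left side equals [8 mu^3 (u Δu - |∇u|^2) / (1 - u)^4]. It vanishes
     because now [Δu = 4 (a_x^2 + b_x^2)] and [|∇u|^2 = 4 u (a_x^2 + b_x^2)]. *)
  field. now apply hne'.
Qed.
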